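(* For every integer $t\ge 3$ there exists $N$ such that for all integers $n\ge N$ and $k\ge 1$ with $n-2k+2=t$, the Kneser graph $\mathrm{KG}(n,k)$ contains an odd $K_t$ minor.
   Context: For $n>2k$, the Kneser graph $\mathrm{KG}(n,k)$ has as vertices all $k$-element subsets of $\{1,\dots,n\}$, two being adjacent iff they are disjoint (its chromatic number is $n-2k+2$). An odd $K_m$ minor of a graph $G$ consists of $m$ pairwise vertex-disjoint trees $T_1,\dots,T_m$ that are subgraphs of $G$, together with a $2$-coloring of the vertices of $T_1\cup\dots\cup T_m$ such that (1) each $T_i$ is properly colored, and (2) for every pair $i\neq j$ there is an edge of $G$ between a vertex of $T_i$ and a vertex of $T_j$ having the same color. *)

(* Defs.v *)
From mathcomp Require Import all_boot.

Set Implicit Arguments.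
Unset Strict Implicit.
Unset Printing Implicit Defensive.

(* A graph on a finite vertex type [T] is given by its adjacency relation      *)
(* [e : rel T]; it is simple when [e] is symmetric and irreflexive.            *)

(* The ground set {1, ..., n} is represented by 'I_n. *)
Definition kneser_vertex (n k : nat) : finType :=
  {A : {set 'I_n} | #|A| == k}.

Definition kneser (n k : nat) : rel (kneser_vertex n k) :=
  fun A B => [disjoint val A & val B].

Lemma kneser_sym (n k : nat) : symmetric (@kneser n k).
Proof. by move=> A B; rewrite /kneser disjoint_sym. Qed.

Lemma kneser_irr (n k : nat) : 0 < k -> irreflexive (@kneser n k).
Proof.
move=> k_gt0 A; apply/negbTE/negP; rewrite /kneser -setI_eq0 setIid -cards_eq0.
by rewrite (eqP (valP A)) -[_ == 0]negbK -lt0n k_gt0.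
Qed.

(* A subgraph is a pair of a vertex set [V] and a set of edges, the latter     *)
(* encoded as the symmetric relation [f].                                      *)
Definition is_subgraph (T : finType) (e : rel T) (V : {set T}) (f : rel T) : Prop :=
  [/\ symmetric f,
      subrel f e
    & forall x y, f x y -> (x \in V) && (y \in V)].

(* Cycles have at least three distinct vertices: for a symmetric [f], a pair   *)
(* of adjacent vertices already satisfies [ucycle f].                          *)
Definition is_tree (T : finType) (V : {set T}) (f : rel T) : Prop :=
  [/\ V != set0,
      {in V &, forall x y, connect f x y}
    & forall s : seq T, 2 < size s -> ~ ucycle f s].

(* The 2-coloring [c] is defined on all of [T], but only its values on the     *)
(* vertices of the trees matter.                                               *)
Definition odd_clique_minor (T : finType) (e : rel T) (m : nat) : Prop :=
  exists (V : 'I_m -> {set T}) (f : 'I_m -> rel T) (c : T -> bool),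
    [/\ forall i, is_subgraph e (V i) (f i) /\ is_tree (V i) (f i),
        forall i j, i != j -> [disjoint V i & V j],
        forall i x y, f i x y -> c x != c y
      & forall i j, i != j ->
          exists x y, [/\ x \in V i, y \in V j, e x y & c x = c y]].

(* Main.v *)
(* Only 2k + 1 ground elements are used: three points s0, s1, s2, a set P of   *)
(* size 2p and a set Q of size 2q, with p + q + 1 = k. A vertex is coloured by *)
(* whether it contains s2. Fixing the trace {s0} / {s1, s2} on the points and  *)
(* the trace q_i / Q \ q_i on Q leaves a copy of the (connected) middle layers *)
(* graph of P, a "row"; fixing {s1} / {s0, s2} and p_i / P \ p_i leaves a      *)
(* "column" which is a copy of the middle layers graph of Q. The i-th tree     *)
(* spans the i-th row and the i-th column, joined at their common trace        *)
(* (p_i, q_i) through the vertex {s2} + (P \ p_i) + (Q \ q_i). Every row meets *)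
(* every column up to complementation: {s0} + (P \ p_j) + q_i in tree i and    *)
(* {s1} + p_j + (Q \ q_i) in tree j are disjoint, and neither contains s2.     *)

Require Import Defs.
From mathcomp Require Import all_boot.
From mathcomp Require Import zify.

Set Implicit Arguments.
Unset Strict Implicit.
Unset Printing Implicit Defensive.

(** In the layout above, the point pattern of a vertex in tree [i] forces its trace on [P] or on [Q]
    to be [p_i], [q_i] or a complement, so distinct halves give disjoint trees ([branch_disjoint]),
    while row [i] meets column [j] in a monochromatic edge ([branch_mono]). Connectivity of the
    middle layers becomes a descent: every vertex but a root has a lower neighbour of the other
    colour ([branch_descent]), which yields properly coloured trees ([descent_odd_minor]). Since
    [t >= 3], [n >= 2k + 1]; for large [n] both [p] and [q] can be at least [t], enough for [t]
    distinct halves on each side. *)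

(** * Trees from height functions *)

Lemma descent_tree (T : finType) (e : rel T) (V : {set T}) (r : T)
    (h : T -> nat) :
  symmetric e -> r \in V ->
  (forall x, x \in V -> x != r -> exists y, [/\ y \in V, e x y & h y < h x]) ->
  exists f : rel T, is_subgraph e V f /\ is_tree V f.
Proof.
move=> e_sym rV descent.
(* The default [r] is never taken on [V] minus the root, by [descent]. *)
pose par x := odflt r [pick y in V | e x y && (h y < h x)].
have parP x : x \in V -> x != r -> [/\ par x \in V, e x (par x) & h (par x) < h x].
  move=> xV x_r; rewrite /par; case: pickP => [y /and3P[] // | none].
  by have [y [yV exy hy]] := descent x xV x_r; have := none y; rewrite /= yV exy hy.
pose child x y := [&& x \in V, x != r & y == par x].
pose f x y := child x y || child y x.
have f_sym : symmetric f by move=> x y; rewrite /f orbC.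
have childP x y : child x y -> [/\ x \in V, y \in V, e x y & h y < h x].
  by case/and3P=> xV x_r /eqP->; have [] := parP x xV x_r.
have to_root x : x \in V -> connect f x r.
  elim: {x}(h x).+1 {-2}x (ltnSn (h x)) => // n IHn x hx xV.
  have [->|x_r] := eqVneq x r; first exact: connect0.
  have [pV _ hp] := parP x xV x_r.
  apply: connect_trans (connect1 _) (IHn _ (leq_trans hp hx) pV).
  by rewrite /f /child xV x_r eqxx.
exists f; split; split=> //.
- by move=> x y /orP[] /childP[_ _ exy _] //; rewrite e_sym.
- by move=> x y /orP[] /childP[xV yV _ _]; apply/andP.
- by apply/set0Pn; exists r.
- move=> x y xV yV; apply: connect_trans (to_root x xV) _.
  by rewrite sym_connect_sym // to_root.
move=> s s_gt2 /andP[s_cycle s_uniq].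
(* Both neighbours on the cycle of a vertex of maximal height are its parent. *)
have [x0 x0s] : exists x, x \in s.
  by case: s s_gt2 {s_cycle s_uniq} => // x s _; exists x; rewrite mem_head.
have [x xs x_max] : exists2 x, x \in s & forall y, y \in s -> h y <= h x.
  by case: (arg_maxnP h x0s) => x xs x_max; exists x.
have nbr y : y \in s -> f x y -> y = par x.
  move=> ys /orP[/and3P[_ _ /eqP] // | /childP[_ _ _]].
  by rewrite ltnNge x_max.
have [i s' rot_s] := rot_to xs.
have s'_sub y : y \in s' -> y \in s.
  by move=> ys'; rewrite -(mem_rot i) rot_s inE ys' orbT.
move: s_gt2 s_cycle s_uniq; rewrite -(size_rot i) -(rot_cycle i) -(rot_uniq i).
rewrite rot_s; case: s' s'_sub {rot_s} => [|y [|z s']] //= s'_sub _.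
rewrite rcons_path => /and3P[fxy _ /andP[_ flx]] /and4P[_ /negP y_notin _ _]; case: y_notin.
have ys : y \in s by rewrite s'_sub ?mem_head.
have ls : last z s' \in s by rewrite s'_sub // inE mem_last orbT.
by rewrite (nbr y ys fxy) -(nbr _ ls) ?mem_last // f_sym.
Qed.

Lemma descent_odd_minor (T : finType) (e : rel T) (m : nat)
    (V : 'I_m -> {set T}) (r : 'I_m -> T) (h : 'I_m -> T -> nat) (c : T -> bool) :
  symmetric e ->
  (forall i, r i \in V i) ->
  (forall i x, x \in V i -> x != r i ->
     exists y, [/\ y \in V i, e x y, c x != c y & h i y < h i x]) ->
  (forall i j, i != j -> [disjoint V i & V j]) ->
  (forall i j, i != j ->
     exists x y, [/\ x \in V i, y \in V j, e x y & c x = c y]) ->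
  odd_clique_minor e m.
Proof.
move=> e_sym rV descent disjV mono.
(* Trees chosen inside the bichromatic subgraph are properly coloured for free. *)
pose e' : rel T := fun x y => e x y && (c x != c y).
have e'_sym : symmetric e' by move=> x y; rewrite /e' e_sym eq_sym.
have tree i : exists f : rel T, is_subgraph e' (V i) f /\ is_tree (V i) f.
  apply: (@descent_tree _ _ _ (r i) (h i)) => // x xV x_r.
  by have [y [yV exy cxy hy]] := descent i x xV x_r; exists y; rewrite /e' exy.
have [f fP] := fin_all_exists tree.
exists V, f, c; split=> // [i | i x y fxy].
  have [[f_sym f_sub f_V] f_tree] := fP i; split=> //; split=> // x y /f_sub.
  by case/andP.
by have [[_ f_sub _] _] := fP i; have /andP[] := f_sub _ _ fxy.
Qed.

(** * Descent in the middle layers graph *)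

(** Some [z] of [x0] is missing from [x]; the complement of [z |: x] works, as adding [z] leaves the
    excess over [x0] unchanged. *)
Lemma middle_layer_up (P : finType) (x x0 : {set P}) :
  #|~: x| = #|x| -> #|x0| = #|x| -> x != x0 ->
  exists w : {set P},
    [/\ #|w|.+1 = #|x|, [disjoint x & w] & #|~: w :\: x0| = #|x :\: x0|].
Proof.
move=> card_xC card_x0 x_x0.
have /subsetPn[z zx0 zx] : ~~ (x0 \subset x).
  by apply: contraNN x_x0 => sub; rewrite eq_sym eqEcard sub card_x0 leqnn.
have wC : ~: ~: (z |: x) :\: x0 = x :\: x0.
  by apply/setP=> a; rewrite setCK !inE; case: eqVneq => [->|]; rewrite ?zx0.
exists (~: (z |: x)); split; last by rewrite wC.
  by have := cardsC (z |: x); rewrite -(cardsC x) cardsU1 zx /=; lia.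
by rewrite -subsets_disjoint subsetUr.
Qed.

Lemma middle_layer_down (P : finType) (w x0 : {set P}) :
  #|~: x0| = #|x0| -> #|w|.+1 = #|x0| ->
  exists x : {set P},
    [/\ #|x| = #|x0|, [disjoint w & x] & #|x :\: x0| < #|~: w :\: x0|].
Proof.
move=> card_x0C card_w; have := cardsC w; rewrite -(cardsC x0) => card_wC.
have /set0Pn[z zP] : ~: w :\: x0 != set0.
  by rewrite -card_gt0 cardsD; have := subset_leq_card (subsetIr (~: w) x0); lia.
have /setDP[zw zx0] := zP.
exists (~: w :\ z); split.
- by have := cardsD1 z (~: w); rewrite zw; lia.
- by rewrite disjoint_sym disjoints_subset subD1set.
- rewrite (cardsD1 z (~: w :\: x0)) zP; apply: subset_leq_card.
  by apply/subsetP=> a; rewrite !inE => /and3P[-> -> ->].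
Qed.

(** * The branches, as sets split over the points, [P] and [Q] *)

(* A subset of the disjoint union of three points, [P] and [Q]; the booleans   *)
(* tell which of the points it contains.                                       *)
Definition split_set (P Q : finType) : finType :=
  (bool * bool * bool * {set P} * {set Q})%type.

Definition split_card (P Q : finType) (v : split_set P Q) : nat :=
  let: (s0, s1, s2, x, y) := v in s0 + s1 + s2 + #|x| + #|y|.

Definition split_disjoint (P Q : finType) : rel (split_set P Q) :=
  fun u v =>
  let: (s0, s1, s2, x, y) := u in let: (s0', s1', s2', x', y') := v in
  [&& ~~ (s0 && s0'), ~~ (s1 && s1'), ~~ (s2 && s2'),
      [disjoint x & x'] & [disjoint y & y']].

Definition color (P Q : finType) (v : split_set P Q) : bool := v.1.1.2.

(* The first two cases form a copy of the middle layers of [P], the last two   *)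
(* a copy of the middle layers of [Q]; the third one is a single vertex that   *)
(* links [(p0, q0)] in the first copy to [(p0, q0)] in the second one.         *)
Definition branch (P Q : finType) (p0 : {set P}) (q0 : {set Q}) :
    pred (split_set P Q) :=
  fun v => let: (s, x, y) := v in
  match s with
  | (true, false, false) => (#|x| == #|p0|) && (y == q0)
  | (false, true, true) => (#|x|.+1 == #|p0|) && (y == ~: q0)
  | (false, false, true) => (x == ~: p0) && (y == ~: q0)
  | (false, true, false) => (x == p0) && (#|y| == #|q0|)
  | (true, false, true) => (x == ~: p0) && (#|y|.+1 == #|q0|)
  | _ => false
  end.

Definition branch_root (P Q : finType) (p0 : {set P}) (q0 : {set Q}) :
  split_set P Q := (true, false, false, p0, q0).

(** Excesses are doubled because steps up keep the excess: the parity then provides the drop. The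
    offset of the column puts its centre at 3, above the link at 2 and the root at 1. *)
Definition branch_height (P Q : finType) (p0 : {set P}) (q0 : {set Q})
    (v : split_set P Q) : nat :=
  let: (s, x, y) := v in
  match s with
  | (true, false, false) => (2 * #|x :\: p0|).+1
  | (false, true, true) => 2 * #|~: x :\: p0|
  | (false, false, true) => 2
  | (false, true, false) => 2 * #|y :\: q0| + 3
  | (true, false, true) => 2 * #|~: y :\: q0| + 2
  | _ => 0
  end.

Lemma branch_card (P Q : finType) (p0 : {set P}) (q0 : {set Q})
    (v : split_set P Q) :
  #|~: p0| = #|p0| -> #|~: q0| = #|q0| -> branch p0 q0 v ->
  split_card v = (#|p0| + #|q0|).+1.
Proof.
move=> card_pC card_qC; case: v => [[[[[] []] []] x] y] //=.
all: by case/andP=> /eqP hx /eqP hy; subst; lia.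
Qed.

Lemma branch_descent (P Q : finType) (p0 : {set P}) (q0 : {set Q})
    (v : split_set P Q) :
  #|~: p0| = #|p0| -> #|~: q0| = #|q0| ->
  branch p0 q0 v -> v != branch_root p0 q0 ->
  exists w, [/\ branch p0 q0 w, split_disjoint v w, color v != color w
             & branch_height p0 q0 w < branch_height p0 q0 v].
Proof.
move=> card_pC card_qC; case: v => [[[[[] []] []] x] y] //=.
- case/andP=> /eqP-> /eqP card_y _.
  have [y' [card_y' dis_y' lt_y']] := middle_layer_down card_qC card_y.
  exists (false, true, false, p0, y'); rewrite /= eqxx card_y' eqxx dis_y'.
  by rewrite disjoints_subset subxx; split=> //; lia.
- case/andP=> /eqP card_x /eqP-> v_root.
  have x_p0 : x != p0 by apply: contraNN v_root => /eqP->.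
  have [|w [card_w dis_w card_wC]] := middle_layer_up _ (esym card_x) x_p0.
    by have := cardsC x; rewrite -(cardsC p0); lia.
  exists (false, true, true, w, ~: q0); rewrite /= card_w card_x !eqxx dis_w.
  by rewrite -subsets_disjoint subxx; split=> //; lia.
- case/andP=> /eqP card_x /eqP-> _.
  have [x' [card_x' dis_x' lt_x']] := middle_layer_down card_pC card_x.
  exists (true, false, false, x', q0); rewrite /= card_x' !eqxx dis_x'.
  by rewrite disjoints_subset subxx; split=> //; lia.
(* At its centre the column is left through the link vertex. *)
- case/andP=> /eqP-> /eqP card_y _; have [->|y_q0] := eqVneq y q0.
    exists (false, false, true, ~: p0, ~: q0); rewrite /= !eqxx.
    by rewrite -!subsets_disjoint !subxx; split=> //; lia.
  have [|w [card_w dis_w card_wC]] := middle_layer_up _ (esym card_y) y_q0.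
    by have := cardsC y; rewrite -(cardsC q0); lia.
  exists (true, false, true, ~: p0, w); rewrite /= card_w card_y !eqxx dis_w.
  by rewrite -subsets_disjoint subxx; split=> //; lia.
- case/andP=> /eqP-> /eqP-> _; exists (branch_root p0 q0); rewrite /= !eqxx.
  by rewrite !disjoints_subset !subxx setDv cards0.
Qed.

(** The five point patterns are distinct, so a common vertex is of the same kind in both branches,
    and each kind fixes one trace. *)
Lemma branch_disjoint (P Q : finType) (p1 p2 : {set P}) (q1 q2 : {set Q})
    (v : split_set P Q) :
  branch p1 q1 v -> branch p2 q2 v -> p1 = p2 \/ q1 = q2.
Proof.
case: v => [[[[[] []] []] x] y] //= /andP[/eqP hx /eqP hy] /andP[/eqP hx' /eqP hy'].
- by left; apply: setC_inj; rewrite -hx.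
- by right; rewrite -hy.
- by right; apply: setC_inj; rewrite -hy.
- by left; rewrite -hx.
- by left; apply: setC_inj; rewrite -hx.
Qed.

Lemma branch_mono (P Q : finType) (p1 p2 : {set P}) (q1 q2 : {set Q}) :
  #|~: p1| = #|p1| -> #|~: q1| = #|q1| -> #|p2| = #|p1| -> #|q2| = #|q1| ->
  exists u v, [/\ branch p1 q1 u, branch p2 q2 v, split_disjoint u v
               & color u = color v].
Proof.
move=> card_pC card_qC card_p2 card_q2.
have := cardsC p2; rewrite -(cardsC p1) => card_p2C.
exists (true, false, false, ~: p2, q1), (false, true, false, p2, ~: q1).
rewrite /= !eqxx /= disjoints_subset subxx -subsets_disjoint subxx.
by split=> //; rewrite ?andbT; apply/eqP; lia.
Qed.

(** * Enough half-size sets *)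

Lemma leq_bin_addn (m p : nat) : 0 < p -> m < 'C(p + m, p).
Proof.
case: p => // p _; elim: m => [|m IHm]; first by rewrite addn0 binn.
rewrite addnS binS -[m.+1]addn1 -[(m + 1).+1]addn1 leq_add // ?addn1 //.
by rewrite bin_gt0; lia.
Qed.

Lemma half_sets (p t : nat) : 0 < p -> t <= p ->
  exists F : 'I_t -> {set 'I_(2 * p)}, injective F /\ forall i, #|F i| = p.
Proof.
move=> p_gt0 le_tp.
pose D := [set A : {set 'I_(2 * p)} | #|A| == p].
have le_tD : t <= #|D|.
  rewrite card_draws card_ord mul2n -addnn.
  exact: leq_trans le_tp (ltnW (leq_bin_addn p p_gt0)).
exists (fun i => enum_val (widen_ord le_tD i)); split.
  by move=> i j /enum_val_inj/(congr1 val)/= ij; apply: val_inj.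
by move=> i; have := enum_valP (widen_ord le_tD i); rewrite inE => /eqP.
Qed.

(** * Transfer to the Kneser graph *)

Definition split_mem (P Q : finType) (v : split_set P Q) (g : 'I_3 + P + Q) :
  bool :=
  let: (s0, s1, s2, x, y) := v in
  match g with
  | inl (inl i) => tnth [tuple s0; s1; s2] i
  | inl (inr a) => a \in x
  | inr b => b \in y
  end.

Lemma card_split_mem (P Q : finType) (v : split_set P Q) :
  #|[set g | split_mem v g]| = split_card v.
Proof.
case: v => [[[[s0 s1] s2] x] y] /=.
rewrite -!sum1_card big_mkcond [in RHS]big_mkcond [X in _ = _ + X]big_mkcond.
rewrite !big_sumType /= !big_ord_recl big_ord0 !inE /=.
congr (_ + _ + _); last by apply: eq_bigr => b _; rewrite inE.
  by case: s0 s1 s2 => [] [] [].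
by apply: eq_bigr => a _; rewrite inE.
Qed.

(** [psi] takes the trace of a [k]-set on an embedded copy of the split ground set. A trace of full
    size [k] is the whole set, hence the restricted injectivity; and disjointness from a set inside
    the copy is visible on traces. *)
Lemma kneser_split (P Q : finType) (n k : nat) :
  #|{: 'I_3 + P + Q}| <= n ->
  exists psi : kneser_vertex n k -> split_set P Q,
    (forall A B, split_card (psi A) = k -> psi A = psi B -> A = B) /\
    (forall v, split_card v = k ->
       exists B, psi B = v /\ forall A, split_disjoint (psi A) v -> kneser A B).
Proof.
move=> le_n; pose emb (g : 'I_3 + P + Q) := widen_ord le_n (enum_rank g).
have emb_inj : injective emb.
  by move=> g g' /(congr1 val)/= /val_inj/enum_rank_inj.
pose pt i := emb (inl (inl i)).
pose psi (A : {set 'I_n}) : split_set P Q :=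
  (pt (inord 0) \in A, pt (inord 1) \in A, pt (inord 2) \in A,
   [set a | emb (inl (inr a)) \in A], [set b | emb (inr b) \in A]).
pose phi v := emb @: [set g | split_mem v g].
have card_phi v : #|phi v| = split_card v.
  by rewrite card_imset // card_split_mem.
have psi_mem A g : split_mem (psi A) g = (emb g \in A).
  case: g => [[i|a]|b] /=; rewrite ?inE // /pt.
  rewrite (tnth_nth false); case: i => -[|[|[|//]]] lt_i3 /=;
    by congr (emb (inl (inl _)) \in A); apply: val_inj; rewrite /= inordK.
have phi_psi A : phi (psi A) \subset A.
  by apply/subsetP=> _ /imsetP[g + ->]; rewrite inE psi_mem.
have psi_phi v : psi (phi v) = v.
  case: v => [[[[s0 s1] s2] x] y]; rewrite /psi /pt /phi !mem_imset // !inE /=.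
  rewrite !(tnth_nth false) /= !inordK //=.
  by congr (_, _, _); apply/setP=> a; rewrite inE mem_imset // inE.
have eq_phi (A : {set _}) : #|A| = k -> split_card (psi A) = k -> phi (psi A) = A.
  move=> card_A card_psi; apply/eqP.
  by rewrite eqEcard phi_psi card_phi card_A card_psi /=.
exists (fun A => psi (val A)); split.
  move=> A B card_psi eq_psi; apply: val_inj.
  rewrite -(eq_phi _ (eqP (valP A)) card_psi) eq_psi.
  by rewrite (eq_phi _ (eqP (valP B))) // -eq_psi.
move=> v card_v; have phi_k : #|phi v| == k by rewrite card_phi card_v.
exists (Sub (phi v) phi_k); rewrite SubK psi_phi; split=> // A dis.
rewrite /kneser SubK disjoint_sym disjoints_subset.
apply/subsetP=> _ /imsetP[g + ->]; rewrite !inE -psi_mem.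
case: v (psi (val A)) dis {card_v phi_k}
  => [[[[s0 s1] s2] x] y] [[[[s0' s1'] s2'] x'] y'].
case/and5P=> d0 d1 d2 dx dy; case: g => [[i|a]|b] /=.
- rewrite !(tnth_nth false); case: i => -[|[|[|//]]] _ /=.
  + by case: s0 s0' d0 => [] [].
  + by case: s1 s1' d1 => [] [].
  + by case: s2 s2' d2 => [] [].
- by move=> ax; rewrite (disjointFl dx ax).
- by move=> bY; rewrite (disjointFl dy bY).
Qed.

Lemma kneser_odd_minor (t p q n k : nat) :
  t <= p -> t <= q -> 0 < p -> 0 < q ->
  k = (p + q).+1 -> 3 + 2 * p + 2 * q <= n ->
  odd_clique_minor (@kneser n k) t.
Proof.
move=> le_tp le_tq p_gt0 q_gt0 def_k le_n.
have [Fp [Fp_inj card_Fp]] := half_sets p_gt0 le_tp.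
have [Fq [Fq_inj card_Fq]] := half_sets q_gt0 le_tq.
have card_FpC i : #|~: Fp i| = #|Fp i|.
  by have := cardsC (Fp i); rewrite card_ord card_Fp; lia.
have card_FqC i : #|~: Fq i| = #|Fq i|.
  by have := cardsC (Fq i); rewrite card_ord card_Fq; lia.
have [|psi [psi_inj psi_onto]] := @kneser_split 'I_(2 * p) 'I_(2 * q) n k.
  by rewrite !card_sum !card_ord.
have card_branch i v : branch (Fp i) (Fq i) v -> split_card v = k.
  by move/(branch_card (card_FpC i) (card_FqC i)); rewrite card_Fp card_Fq def_k.
pose V i := [set A : kneser_vertex n k | branch (Fp i) (Fq i) (psi A)].
have branch_root_in i : branch (Fp i) (Fq i) (branch_root (Fp i) (Fq i)).
  by rewrite /= !eqxx.
have root_vertex i :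
    exists A : kneser_vertex n k, psi A = branch_root (Fp i) (Fq i).
  have [A [psi_A _]] := psi_onto _ (card_branch _ _ (branch_root_in i)).
  by exists A.
have [r psi_r] := fin_all_exists root_vertex.
apply: (@descent_odd_minor _ _ _ V r
  (fun i A => branch_height (Fp i) (Fq i) (psi A)) (fun A => color (psi A))).
- exact: kneser_sym.
- by move=> i; rewrite inE psi_r.
- move=> i A; rewrite inE => AV A_r.
  have [|w [wV dis_w col_w lt_w]] := branch_descent (card_FpC i) (card_FqC i) AV.
    apply: contraNN A_r => /eqP psi_A.
    by apply/eqP/psi_inj; [apply: card_branch AV | rewrite psi_A psi_r].
  have [B [psi_B adj_B]] := psi_onto w (card_branch _ _ wV).
  by exists B; rewrite inE psi_B adj_B.
- move=> i j i_j; rewrite disjoints_subset; apply/subsetP=> A; rewrite !inE => Ai.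
  by apply: contraNN i_j => /(branch_disjoint Ai)[/Fp_inj->|/Fq_inj->].
- move=> i j _.
  have [||u [v [uV vV dis_uv col_uv]]] :=
    @branch_mono _ _ (Fp i) (Fp j) (Fq i) (Fq j) (card_FpC i) (card_FqC i).
  + by rewrite !card_Fp.
  + by rewrite !card_Fq.
  have [A [psi_A _]] := psi_onto u (card_branch _ _ uV).
  have [B [psi_B adj_B]] := psi_onto v (card_branch _ _ vV).
  by exists A, B; rewrite !inE psi_A psi_B adj_B ?psi_A.
Qed.

Theorem theorem3 (t : nat) (ht : 3 <= t) :
  exists N : nat, forall n k : nat,
    N <= n -> 1 <= k -> n - 2 * k + 2 = t ->
    odd_clique_minor (@kneser n k) t.
Proof.
(* As [n = 2k + t - 2], the bound gives [k >= 2t + 1], so with [p = t] the remaining [q = k - t - 1]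
   is at least [t]. *)
exists (5 * t) => n k le_n _ def_t.
by apply: (@kneser_odd_minor t t (k - t.+1)); lia.
Qed.
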